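(* Suppose that a group $G$ acts geometrically on a CAT(0) space $X$ and $|\partial X|>2$. If $X$ contains a quasi-dense subset which splits as a product $X_1\times X_2$ with $X_1$ and $X_2$ unbounded, then the boundary $\partial X$ is not a scrambled set.
   Context: A geometric action is an action by isometries which is proper and cocompact. A subset $A$ of a metric space $Y$ is quasi-dense if there is $K>0$ with $\{y\in Y\mid d(y,a)\le K\text{ for some }a\in A\}=Y$. $\partial X$ is the visual boundary with metric $d_{\partial X}(\alpha,\beta)=\sum_{i=1}^\infty\min\{d(\xi_{x_0,\alpha}(i),\xi_{x_0,\beta}(i)),2^{-i}\}$ for a fixed basepoint $x_0$, $\xi_{x_0,\alpha}$ being the geodesic ray from $x_0$ to $\alpha$. $\partial X$ is a scrambled set if for all $\alpha\neq\beta$, $\limsup\{d_{\partial X}(g\alpha,g\beta)\mid g\in G\}>0$ and $\liminf\{d_{\partial X}(g\alpha,g\beta)\mid g\in G\}=0$ (as $g$ leaves finite subsets of $G$). *)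

(* Defs.v *)
From Stdlib Require Import Reals List ClassicalEpsilon.
From Coquelicot Require Import Coquelicot.
Open Scope R_scope.

Definition is_group {G : Type} (mul : G -> G -> G) (inv : G -> G) (e : G) : Prop :=
  (forall a b c, mul a (mul b c) = mul (mul a b) c) /\
  (forall a, mul e a = a /\ mul a e = a) /\
  (forall a, mul (inv a) a = e /\ mul a (inv a) = e).

Definition fin_subset {G : Type} (P : G -> Prop) : Prop :=
  exists l : list G, forall g, P g -> In g l.

Definition is_metric {X : Type} (d : X -> X -> R) : Prop :=
  (forall x y, d x y = 0 <-> x = y) /\
  (forall x y, d x y = d y x) /\
  (forall x y z, d x z <= d x y + d y z).

Definition unbounded {X : Type} (d : X -> X -> R) : Prop :=
  forall M : R, exists x y, M < d x y.

Definition m_open {X : Type} (d : X -> X -> R) (U : X -> Prop) : Prop :=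
  forall x, U x -> exists r, 0 < r /\ forall y, d x y < r -> U y.

Definition m_compact {X : Type} (d : X -> X -> R) (K : X -> Prop) : Prop :=
  forall (I : Type) (U : I -> X -> Prop),
    (forall i, m_open d (U i)) ->
    (forall x, K x -> exists i, U i x) ->
    exists l : list I, forall x, K x -> exists i, In i l /\ U i x.

Definition geod {X : Type} (d : X -> X -> R) (x y : X) (c : R -> X) : Prop :=
  c 0 = x /\ c (d x y) = y /\
  forall s t, 0 <= s <= d x y -> 0 <= t <= d x y -> d (c s) (c t) = Rabs (s - t).

Definition geodesic_space {X : Type} (d : X -> X -> R) : Prop :=
  forall x y, exists c, geod d x y c.

Definition eucl (P Q : R * R) : R :=
  sqrt ((fst P - fst Q) ^ 2 + (snd P - snd Q) ^ 2).

(* point at arc length s on the Euclidean segment from P to Q of length a *)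
Definition seg_pt (P Q : R * R) (a s : R) : R * R :=
  (fst P + (s / a) * (fst Q - fst P), snd P + (s / a) * (snd Q - snd P)).

Definition CAT0 {X : Type} (d : X -> X -> R) : Prop :=
  geodesic_space d /\
  forall (p q r : X) (c1 c2 c3 : R -> X),
    geod d p q c1 -> geod d q r c2 -> geod d r p c3 ->
    forall P Q Rr : R * R,
      eucl P Q = d p q -> eucl Q Rr = d q r -> eucl Rr P = d r p ->
      let pt (i : nat) (s : R) := match i with 0%nat => c1 s | 1%nat => c2 s | _ => c3 s end in
      let len (i : nat) := match i with 0%nat => d p q | 1%nat => d q r | _ => d r p end in
      let cpt (i : nat) (s : R) := match i with
                                   | 0%nat => seg_pt P Q (d p q) s
                                   | 1%nat => seg_pt Q Rr (d q r) s
                                   | _ => seg_pt Rr P (d r p) s end in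
      forall (i j : nat) (s t : R), (i < 3)%nat -> (j < 3)%nat ->
        0 <= s <= len i -> 0 <= t <= len j ->
        d (pt i s) (pt j t) <= eucl (cpt i s) (cpt j t).

Definition isometric_action {G X : Type} (mul : G -> G -> G) (e : G)
  (d : X -> X -> R) (act : G -> X -> X) : Prop :=
  (forall x, act e x = x) /\
  (forall g h x, act (mul g h) x = act g (act h x)) /\
  (forall g x y, d (act g x) (act g y) = d x y).

(* proper (Bridson-Haefliger I.8.2): each point has a ball B(x,r) with
   {g | g B(x,r) meets B(x,r)} finite *)
Definition proper_action {G X : Type} (d : X -> X -> R) (act : G -> X -> X) : Prop :=
  forall x, exists r, 0 < r /\
    fin_subset (fun g => exists y, d x y < r /\ d x (act g y) < r).

Definition cocompact_action {G X : Type} (d : X -> X -> R) (act : G -> X -> X) : Prop :=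
  exists K, m_compact d K /\ forall x, exists g k, K k /\ act g k = x.

Definition geometric_action {G X : Type} (mul : G -> G -> G) (e : G)
  (d : X -> X -> R) (act : G -> X -> X) : Prop :=
  isometric_action mul e d act /\ proper_action d act /\ cocompact_action d act.

Definition quasi_dense {X : Type} (d : X -> X -> R) (A : X -> Prop) : Prop :=
  exists K, 0 < K /\ forall y, exists a, A a /\ d y a <= K.

Definition splits_as_product {X X1 X2 : Type} (d : X -> X -> R)
  (d1 : X1 -> X1 -> R) (d2 : X2 -> X2 -> R) (A : X -> Prop) : Prop :=
  exists phi : X1 * X2 -> X,
    (forall a, A a <-> exists z, phi z = a) /\
    (forall z w, d (phi z) (phi w) =
                 sqrt (d1 (fst z) (fst w) ^ 2 + d2 (snd z) (snd w) ^ 2)).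

Definition has_quasi_dense_unbounded_product {X : Type} (d : X -> X -> R) : Prop :=
  exists (A : X -> Prop) (X1 X2 : Type) (d1 : X1 -> X1 -> R) (d2 : X2 -> X2 -> R),
    quasi_dense d A /\ is_metric d1 /\ is_metric d2 /\
    unbounded d1 /\ unbounded d2 /\ splits_as_product d d1 d2 A.

(* geodesic ray issuing from x0 (only its values on [0,oo) matter) *)
Definition ray_from {X : Type} (d : X -> X -> R) (x0 : X) (c : R -> X) : Prop :=
  c 0 = x0 /\ forall s t, 0 <= s -> 0 <= t -> d (c s) (c t) = Rabs (s - t).

Definition same_ray {X : Type} (c c' : R -> X) : Prop :=
  forall t, 0 <= t -> c t = c' t.

Definition asymptotic {X : Type} (d : X -> X -> R) (c c' : R -> X) : Prop :=
  exists C, forall t, 0 <= t -> d (c t) (c' t) <= C.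

(* points of \partial X are represented by the geodesic rays from x0 (up to
   same_ray); the action of g sends alpha to the ray from x0 asymptotic to
   g o alpha (exists and is unique in a proper CAT(0) space) *)
Definition bd_act {G X : Type} (d : X -> X -> R) (act : G -> X -> X) (x0 : X)
  (g : G) (alpha : R -> X) : R -> X :=
  epsilon (inhabits (fun _ : R => x0))
    (fun c => ray_from d x0 c /\ asymptotic d c (fun t => act g (alpha t))).

Definition bd_dist {X : Type} (d : X -> X -> R) (alpha beta : R -> X) : R :=
  Series (fun n : nat =>
    Rmin (d (alpha (INR (S n))) (beta (INR (S n)))) (/ 2 ^ (S n))).

(* scrambled: limsup_{g -> oo} d(g a, g b) > 0 and liminf_{g -> oo} d(g a, g b) = 0,
   where "g -> oo" means g leaves finite subsets of G *)
Definition scrambled {G X : Type} (d : X -> X -> R) (act : G -> X -> X) (x0 : X) : Prop :=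
  forall alpha beta : R -> X,
    ray_from d x0 alpha -> ray_from d x0 beta -> ~ same_ray alpha beta ->
    (exists eps, 0 < eps /\
       forall F : list G, exists g, ~ In g F /\
         eps <= bd_dist d (bd_act d act x0 g alpha) (bd_act d act x0 g beta)) /\
    (forall eps, 0 < eps ->
       forall F : list G, exists g, ~ In g F /\
         bd_dist d (bd_act d act x0 g alpha) (bd_act d act x0 g beta) < eps).

(* Main.v *)
(** Let [alpha] and [beta] be limits of geodesics from [x0] towards points going to
    infinity in the [X1]-direction and in the [X2]-direction.  A ray asymptotic to
    [alpha] from a point [K]-close to [(y1, y2)] is at time [T] within [2K + 1] of a
    point [(u, v)] of the product with [d1 y1 u >= T - K] and [d2 y2 v <= 2 sqrt (T K)],
    and symmetrically for [beta].  So for a fixed large [T] the rays from any common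
    origin towards [alpha] and [beta] are at distance at least 1 at time [T].  Applied
    to the origins [g^-1 x0], this bounds the distance of [g alpha] and [g beta] from
    below by [2^-T], uniformly in [g].  Neither completeness of the factors nor
    a splitting of [X] is involved: the error [sqrt (T K)] is sublinear in [T]. *)

Require Import Defs.
From Stdlib Require Import Reals List Lra Lia Psatz ClassicalEpsilon.
From Coquelicot Require Import Coquelicot.
Open Scope R_scope.

(** * Metric preliminaries and convexity of distance in CAT(0) spaces *)

Lemma metric_refl {X : Type} (d : X -> X -> R) (Hm : is_metric d) x : d x x = 0.
Proof. now apply (proj1 Hm). Qed.

Lemma metric_sym {X : Type} (d : X -> X -> R) (Hm : is_metric d) x y : d x y = d y x.
Proof. apply (proj1 (proj2 Hm)). Qed.

Lemma metric_tri {X : Type} (d : X -> X -> R) (Hm : is_metric d) x y z :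
  d x z <= d x y + d y z.
Proof. apply (proj2 (proj2 Hm)). Qed.

Lemma metric_nonneg {X : Type} (d : X -> X -> R) (Hm : is_metric d) x y : 0 <= d x y.
Proof.
  pose proof (metric_tri d Hm x y x). rewrite (metric_refl d Hm) in H.
  rewrite (metric_sym d Hm y x) in H. lra.
Qed.

Lemma comparison_triangle (a b c : R) :
  0 <= a -> 0 <= b -> 0 <= c -> a <= b + c -> b <= a + c -> c <= a + b ->
  exists P Q S : R * R, eucl P Q = a /\ eucl Q S = b /\ eucl S P = c.
Proof.
  intros Ha Hb Hc H1 H2 H3.
  destruct (Req_dec a 0) as [->|Hn].
  - exists (0, 0), (0, 0), (b, 0). unfold eucl; simpl.
    assert (b = c) as -> by lra.
    replace ((0 - 0) * ((0 - 0) * 1) + (0 - 0) * ((0 - 0) * 1)) with (0 * 0) by ring.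
    replace ((0 - c) * ((0 - c) * 1) + (0 - 0) * ((0 - 0) * 1)) with (c * c) by ring.
    replace ((c - 0) * ((c - 0) * 1) + (0 - 0) * ((0 - 0) * 1)) with (c * c) by ring.
    rewrite !sqrt_square by lra. auto.
  (* The law of cosines gives the abscissa of the third vertex once the first two are [(0, 0)] and
     [(a, 0)]; the triangle inequalities say exactly that it has absolute value at most [c]. *)
  - pose (x := (a * a + c * c - b * b) / (2 * a)).
    assert (Hx : 2 * a * x = a * a + c * c - b * b) by (unfold x; field; lra).
    assert (Hy : 0 <= c * c - x * x).
    { assert (x <= c) by nra. assert (- c <= x) by nra. nra. }
    exists (0, 0), (a, 0), (x, sqrt (c * c - x * x)). unfold eucl; simpl.
    pose proof (sqrt_sqrt _ Hy) as Hs.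
    set (y := sqrt (c * c - x * x)) in *.
    replace ((0 - a) * ((0 - a) * 1) + (0 - 0) * ((0 - 0) * 1)) with (a * a) by ring.
    replace ((a - x) * ((a - x) * 1) + (0 - y) * ((0 - y) * 1)) with (b * b) by nra.
    replace ((x - 0) * ((x - 0) * 1) + (y - 0) * ((y - 0) * 1)) with (c * c) by nra.
    rewrite !sqrt_square by lra. auto.
Qed.

Lemma geod_rev {X : Type} (d : X -> X -> R) (Hm : is_metric d) x y c :
  geod d x y c -> geod d y x (fun s => c (d x y - s)).
Proof.
  intros (H0 & H1 & H2). unfold geod. rewrite (metric_sym d Hm y x).
  repeat split.
  - now rewrite Rminus_0_r.
  - now rewrite Rminus_diag.
  - intros s t Hs Ht. rewrite H2 by lra.
    rewrite <- Rabs_Ropp. f_equal. ring.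
Qed.

(** If [a = 0], the quotient in [seg_pt] divides by zero, but the endpoints coincide and its value
    does not matter. *)
Lemma seg_pt_barycentric (P Q : R * R) (a t : R) :
  eucl P Q = a ->
  seg_pt P Q a (t * a) = (fst P + t * (fst Q - fst P), snd P + t * (snd Q - snd P)).
Proof.
  intros H. unfold seg_pt. destruct (Req_dec a 0) as [Ha|Ha].
  - rewrite Ha in *. unfold eucl in H. pose proof (pow2_ge_0 (fst P - fst Q)). pose proof (pow2_ge_0 (snd P - snd Q)).
    apply sqrt_eq_0 in H; [|lra].
    assert (fst Q - fst P = 0) as -> by nra.
    assert (snd Q - snd P = 0) as -> by nra. f_equal; ring.
  - f_equal; field; auto.
Qed.

(** In the comparison triangle, the points at ratio [t] from a common vertex are at distance exactly
    [t] times the opposite side. The second side runs from [r] to [p] in [CAT0], hence the reversed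
    geodesic and the parameter [1 - t]. *)
Lemma CAT0_vertex {X : Type} (d : X -> X -> R) (Hm : is_metric d) (HC : CAT0 d)
  p q r c c' t :
  geod d p q c -> geod d p r c' -> 0 <= t <= 1 ->
  d (c (t * d p q)) (c' (t * d p r)) <= t * d q r.
Proof.
  intros Hc Hc' Ht. destruct HC as [Hg HC].
  destruct (Hg q r) as [c2 Hc2].
  pose proof (metric_nonneg d Hm) as Hp.
  pose proof (metric_tri d Hm) as Htri.
  pose proof (metric_sym d Hm) as Hsym.
  destruct (comparison_triangle (d p q) (d q r) (d r p)) as (P & Q & S & E1 & E2 & E3); auto.
  { specialize (Htri p r q). rewrite (Hsym q r), (Hsym r p). lra. }
  { specialize (Htri q p r). rewrite (Hsym p q), (Hsym r p). lra. }
  { specialize (Htri r q p). rewrite (Hsym p q), (Hsym q r). lra. }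
  pose proof (Hp p q). pose proof (Hp r p). pose proof (Hp q r).
  specialize (HC p q r c c2 _ Hc Hc2 (geod_rev d Hm _ _ _ Hc') P Q S E1 E2 E3
    0%nat 2%nat (t * d p q) ((1 - t) * d r p)).
  simpl in HC.
  replace (d p r - (1 - t) * d r p) with (t * d p r) in HC by (rewrite (Hsym r p); ring).
  eapply Rle_trans; [apply HC; try lia; nra|].
  rewrite (seg_pt_barycentric P Q), (seg_pt_barycentric S P) by auto.
  right. rewrite <- E2. unfold eucl; simpl.
  rewrite <- (sqrt_square t) by lra. rewrite <- sqrt_mult_alt by nra.
  rewrite (sqrt_square t) by lra.
  f_equal. ring.
Qed.

(** The diagonal from [x] to [y'] cuts the quadrilateral into two triangles; [CAT0_vertex] applies
    at [x] with ratio [t] and at [y'] with ratio [1 - t]. *)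
Lemma CAT0_convex {X : Type} (d : X -> X -> R) (Hm : is_metric d) (HC : CAT0 d)
  x y x' y' c c' t :
  geod d x y c -> geod d x' y' c' -> 0 <= t <= 1 ->
  d (c (t * d x y)) (c' (t * d x' y')) <= (1 - t) * d x x' + t * d y y'.
Proof.
  intros Hc Hc' Ht.
  destruct (proj1 HC x y') as [c2 Hc2].
  pose proof (CAT0_vertex d Hm HC _ _ _ _ _ t Hc Hc2 Ht) as H1.
  pose proof (CAT0_vertex d Hm HC _ _ _ _ _ (1 - t)
    (geod_rev d Hm _ _ _ Hc2) (geod_rev d Hm _ _ _ Hc') ltac:(lra)) as H2.
  cbv beta in H2.
  rewrite !(metric_sym d Hm y') in H2.
  replace (d x y' - (1 - t) * d x y') with (t * d x y') in H2 by ring.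
  replace (d x' y' - (1 - t) * d x' y') with (t * d x' y') in H2 by ring.
  pose proof (metric_tri d Hm (c (t * d x y)) (c2 (t * d x y')) (c' (t * d x' y'))).
  lra.
Qed.

(** Convexity bounds the distance at proportional parameters by [E]. The two lengths differ by at
    most [2 * E], so passing to equal arc length costs another [2 * E]. *)
Lemma geod_fellow_travel {X : Type} (d : X -> X -> R) (Hm : is_metric d) (HC : CAT0 d)
  x y x' y' c c' E s :
  geod d x y c -> geod d x' y' c' -> d x x' <= E -> d y y' <= E ->
  0 <= s <= d x y -> 0 <= s <= d x' y' ->
  d (c s) (c' s) <= 3 * E.
Proof.
  intros Hc Hc' Hx Hy Hs Hs'.
  pose proof (metric_nonneg d Hm x x').
  destruct (Req_dec (d x y) 0) as [E0|E0].
  { assert (s = 0) as -> by lra. rewrite (proj1 Hc), (proj1 Hc'). lra. }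
  pose (t := s / d x y).
  assert (Ht : t * d x y = s) by (unfold t; field; auto).
  assert (Ht1 : 0 <= t <= 1) by (split; nra).
  pose proof (CAT0_convex d Hm HC _ _ _ _ _ _ t Hc Hc' Ht1) as H1.
  rewrite Ht in H1.
  assert (HD : Rabs (d x y - d x' y') <= 2 * E).
  { pose proof (metric_tri d Hm x x' y). pose proof (metric_tri d Hm x' y' y).
    pose proof (metric_tri d Hm x' x y'). pose proof (metric_tri d Hm x y y').
    rewrite (metric_sym d Hm x' x) in *. rewrite (metric_sym d Hm y' y) in *.
    apply Rabs_le. lra. }
  assert (H2 : d (c' (t * d x' y')) (c' s) <= 2 * E).
  { rewrite (proj2 (proj2 Hc')) by nra.
    rewrite <- Ht. replace (t * d x' y' - t * d x y) with (- (t * (d x y - d x' y'))) by ring.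
    rewrite Rabs_Ropp, Rabs_mult, (Rabs_pos_eq t) by lra.
    pose proof (Rabs_pos (d x y - d x' y')). nra. }
  pose proof (metric_tri d Hm (c s) (c' (t * d x' y')) (c' s)).
  nra.
Qed.

Lemma geod_initial {X : Type} (d : X -> X -> R) x y c S :
  geod d x y c -> 0 <= S <= d x y -> d x (c S) = S /\ geod d x (c S) c.
Proof.
  intros (H0 & H1 & H2) HS.
  assert (H3 : d x (c S) = S).
  { rewrite <- H0 at 1. rewrite H2 by lra. rewrite Rabs_minus_sym, Rminus_0_r.
    apply Rabs_pos_eq; lra. }
  split; auto. split; [auto|]. rewrite H3. split; [auto|].
  intros; apply H2; lra.
Qed.

Lemma ray_initial {X : Type} (d : X -> X -> R) x c S :
  ray_from d x c -> 0 <= S -> d x (c S) = S /\ geod d x (c S) c.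
Proof.
  intros (H0 & H2) HS.
  assert (H3 : d x (c S) = S).
  { rewrite <- H0 at 1. rewrite H2 by lra. rewrite Rabs_minus_sym, Rminus_0_r.
    apply Rabs_pos_eq; lra. }
  split; auto. split; [auto|]. rewrite H3. split; [auto|].
  intros; apply H2; lra.
Qed.

(** Used with [S] much larger than [T]: a bounded gap at time [S] then contributes almost nothing at
    time [T], and only the distance of the origins remains. *)
Lemma convex_initial {X : Type} (d : X -> X -> R) (Hm : is_metric d) (HC : CAT0 d)
  x x' c c' S T :
  geod d x (c S) c -> geod d x' (c' S) c' -> d x (c S) = S -> d x' (c' S) = S ->
  0 < S -> 0 <= T <= S ->
  d (c T) (c' T) <= (1 - T / S) * d x x' + T / S * d (c S) (c' S).
Proof.
  intros Hc Hc' E E' HS HT.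
  assert (Hq : T / S * S = T) by (field; lra).
  assert (0 <= T / S <= 1) by (split; nra).
  pose proof (CAT0_convex d Hm HC _ _ _ _ _ _ (T / S) Hc Hc' H) as H1.
  rewrite E, E', !Hq in H1. exact H1.
Qed.

(** * Finiteness properties of proper cocompact actions *)

Lemma fin_subset_incl {G : Type} (P Q : G -> Prop) :
  (forall g, P g -> Q g) -> fin_subset Q -> fin_subset P.
Proof. intros H [l Hl]. exists l. auto. Qed.

Lemma fin_subset_union {G : Type} (P Q : G -> Prop) :
  fin_subset P -> fin_subset Q -> fin_subset (fun g => P g \/ Q g).
Proof.
  intros [l Hl] [l' Hl']. exists (l ++ l'). intros g [H|H]; apply in_or_app; auto.
Qed.

Lemma fin_subset_list_union {G I : Type} (l : list I) (P : I -> G -> Prop) :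
  (forall i, In i l -> fin_subset (P i)) ->
  fin_subset (fun g => exists i, In i l /\ P i g).
Proof.
  induction l as [|i l IH]; intros H.
  - exists nil. intros g (i & [] & _).
  - apply (fin_subset_incl _ (fun g => P i g \/ exists j, In j l /\ P j g)).
    + intros g (j & [<-|Hj] & Hg); eauto.
    + apply fin_subset_union; [apply H; now left|].
      apply IH. intros j Hj. apply H. now right.
Qed.

Lemma fin_subset_image {G H : Type} (f : H -> G) (P : G -> Prop) (Q : H -> Prop) :
  (forall g, P g -> exists h, Q h /\ f h = g) -> fin_subset Q -> fin_subset P.
Proof.
  intros HPQ [l Hl]. exists (map f l). intros g Hg.
  destruct (HPQ g Hg) as (h & Hh & <-). apply in_map. auto.
Qed.

Lemma inv_involutive {G : Type} (mul : G -> G -> G) (inv : G -> G) (e : G) :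
  is_group mul inv e -> forall g, inv (inv g) = g.
Proof.
  intros (Ha & He & Hi) g.
  rewrite <- (proj2 (He (inv (inv g)))), <- (proj1 (Hi g)), Ha, (proj1 (Hi (inv g))).
  apply (proj1 (He g)).
Qed.

Lemma act_inv_l {G X : Type} (mul : G -> G -> G) (inv : G -> G) (e : G) (d : X -> X -> R)
  (act : G -> X -> X) :
  is_group mul inv e -> isometric_action mul e d act ->
  forall g x, act (inv g) (act g x) = x.
Proof.
  intros (Ha & He & Hi) (A1 & A2 & A3) g x.
  rewrite <- A2, (proj1 (Hi g)). apply A1.
Qed.

Lemma act_inv_r {G X : Type} (mul : G -> G -> G) (inv : G -> G) (e : G) (d : X -> X -> R)
  (act : G -> X -> X) :
  is_group mul inv e -> isometric_action mul e d act ->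
  forall g x, act g (act (inv g) x) = x.
Proof.
  intros (Ha & He & Hi) (A1 & A2 & A3) g x.
  rewrite <- A2, (proj2 (Hi g)). apply A1.
Qed.

Definition proper_radius {G X : Type} (d : X -> X -> R) (act : G -> X -> X)
  (x : X) (r : R) : Prop :=
  0 < r /\ fin_subset (fun g => exists y, d x y < r /\ d x (act g y) < r).

(** If some [g0] brings [x] into the ball, every other such [g] makes [mul g (inv g0)] return a
    point of the ball to the ball, so [g] lies in a right translate by [g0] of a finite set. *)
Lemma finite_orbit_near {G X : Type} (mul : G -> G -> G) (inv : G -> G) (e : G)
  (d : X -> X -> R) (act : G -> X -> X) (y : X) (r : R) :
  is_group mul inv e -> isometric_action mul e d act -> proper_radius d act y r ->
  forall x, fin_subset (fun g => d y (act g x) < r).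
Proof.
  intros HG HA [Hr HF] x.
  destruct (classic (exists g0, d y (act g0 x) < r)) as [[g0 H0]|Hn].
  - refine (fin_subset_image (fun h => mul h g0) _ _ _ HF).
    intros g Hg. exists (mul g (inv g0)). split.
    + exists (act g0 x). split; auto.
      destruct HA as (A1 & A2 & A3). rewrite A2.
      rewrite (act_inv_l mul inv e d act HG (conj A1 (conj A2 A3))). exact Hg.
    + destruct HG as (Ha & He & Hi). rewrite <- Ha, (proj1 (Hi g0)). apply He.
  - exists nil. intros g Hg. apply Hn. eauto.
Qed.

(** The bound is restricted to positive values because the list extracted from a cover may also
    contain indices with a nonpositive radius. *)
Lemma list_uniform_bound {I : Type} (l : list I) (f : I -> R) :
  exists eps, 0 < eps /\ forall i, In i l -> 0 < f i -> eps <= f i.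
Proof.
  induction l as [|i l (eps & He & IH)].
  - exists 1. split; [lra|]. intros i [].
  - destruct (Rlt_dec 0 (f i)) as [Hi|Hi].
    + exists (Rmin eps (f i)). split; [now apply Rmin_pos|].
      intros j [<-|Hj] Hp; [apply Rmin_r|].
      eapply Rle_trans; [apply Rmin_l|auto].
    + exists eps. split; auto. intros j [<-|Hj] Hp; auto. lra.
Qed.

(** The proposition [P] allows covers indexed by a full product type: an index that violates its
    side condition contributes the empty set. *)
Lemma m_open_ball {X : Type} (d : X -> X -> R) (Hm : is_metric d) x r (P : Prop) :
  m_open d (fun y => P /\ d x y < r).
Proof.
  intros y [HP Hy]. exists (r - d x y). split; [lra|].
  intros z Hz. split; auto. pose proof (metric_tri d Hm x y z). lra.
Qed.

(* The definition of properness only controls one ball at a time; two elements moving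
   a small ball near [x] into the ball of a point [y] of larger radius differ by
   an element returning to the ball of [y], which gives finiteness for pairs of balls. *)
Lemma compact_finite_return {G X : Type} (mul : G -> G -> G) (inv : G -> G) (e : G)
  (d : X -> X -> R) (act : G -> X -> X) (K : X -> Prop) :
  is_group mul inv e -> is_metric d -> isometric_action mul e d act ->
  proper_action d act -> m_compact d K ->
  exists eps, 0 < eps /\
    fin_subset (fun g => exists k k', K k /\ K k' /\ d k' (act g k) < eps).
Proof.
  intros HG Hm HA HP HK.
  destruct (HK (X * R)%type (fun p y => proper_radius d act (fst p) (snd p) /\
    d (fst p) y < snd p / 6)) as [l Hl].
  { intros p. apply m_open_ball; auto. }
  { intros x _. destruct (HP x) as (r & Hr & HF). exists (x, r). simpl. split.
    - split; auto.
    - rewrite (metric_refl d Hm). lra. }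
  destruct (list_uniform_bound l (fun p => snd p / 6)) as (eps & He & Hle).
  exists eps. split; auto.
  apply (fin_subset_incl _ (fun g => exists p, In p l /\ exists q, In q l /\
    ((proper_radius d act (fst q) (snd q) /\ d (fst q) (act g (fst p)) < snd q) \/
     (proper_radius d act (fst p) (snd p) /\ d (fst p) (act (inv g) (fst q)) < snd p)))).
  - intros g (k & k' & Hk & Hk' & Hd).
    destruct (Hl k Hk) as (p & Hp & Pp & Hpk).
    destruct (Hl k' Hk') as (q & Hq & Pq & Hqk).
    exists p. split; auto. exists q. split; auto.
    pose proof (Hle p Hp ltac:(destruct Pp; lra)).
    pose proof (Hle q Hq ltac:(destruct Pq; lra)).
    assert (HA' := HA). destruct HA' as (A1 & A2 & A3).
    assert (D1 : d (fst q) (act g k) < snd q / 3).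
    { pose proof (metric_tri d Hm (fst q) k' (act g k)). lra. }
    assert (D2 : d (act g k) (act g (fst p)) < snd p / 6).
    { rewrite A3, (metric_sym d Hm). exact Hpk. }
    pose proof (metric_tri d Hm (fst q) (act g k) (act g (fst p))) as D3.
    assert (D4 : d (fst p) (act (inv g) (fst q)) = d (fst q) (act g (fst p))).
    { rewrite <- (A3 g), (act_inv_r mul inv e d act HG HA). apply (metric_sym d Hm). }
    (* The distance is below [snd q / 3 + snd p / 6], hence below the larger radius. If that is
       [snd p], the roles are exchanged by [inv g]. *)
    destruct (Rle_dec (snd p) (snd q)); [left|right]; split; auto; lra.
  - apply fin_subset_list_union. intros p _.
    apply fin_subset_list_union. intros q _.
    apply fin_subset_union.
    + destruct (classic (proper_radius d act (fst q) (snd q))) as [H|H].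
      * eapply fin_subset_incl; [|apply (finite_orbit_near mul inv e d act _ _ HG HA H (fst p))].
        intros g [_ Hg]; exact Hg.
      * exists nil. tauto.
    + destruct (classic (proper_radius d act (fst p) (snd p))) as [H|H].
      * eapply (fin_subset_image inv);
          [|apply (finite_orbit_near mul inv e d act _ _ HG HA H (fst q))].
        intros g [_ Hg]. exists (inv g). split; auto.
        apply (inv_involutive mul inv e HG).
      * exists nil. tauto.
Qed.

(** Induction on the radius in steps of [eps / 2] along geodesics from [x0]. If [act g k] is a point
    of the smaller ball within [eps / 2] of [act h k'], then [mul (inv g) h] moves [k'] to within
    [eps] of [k], so it belongs to the finite set [S] of returns, and [h] is [g] times an element of
    [S]. *)
Lemma bounded_finite_translates {G X : Type} (mul : G -> G -> G) (inv : G -> G) (e : G)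
  (d : X -> X -> R) (act : G -> X -> X) (x0 : X) :
  is_group mul inv e -> is_metric d -> geodesic_space d -> geometric_action mul e d act ->
  exists K, m_compact d K /\ forall r, exists l : list G, forall y, d x0 y <= r ->
    exists g k, In g l /\ K k /\ act g k = y.
Proof.
  intros HG Hm Hg (HA & HP & K & HK & Hcov).
  exists K. split; auto.
  destruct (compact_finite_return mul inv e d act K HG Hm HA HP HK) as (eps & He & S & HS).
  assert (HA' := HA). destruct HA' as (A1 & A2 & A3).
  assert (Hn : forall n : nat, exists l : list G, forall y, d x0 y <= INR n * (eps / 2) ->
    exists g k, In g l /\ K k /\ act g k = y).
  { induction n as [|n [l IH]].
    - destruct (Hcov x0) as (g & k & Hk & E). exists (g :: nil). intros y Hy.
      exists g, k. split; [now left|]. split; auto. rewrite E.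
      apply (proj1 Hm). pose proof (metric_nonneg d Hm x0 y). simpl in Hy. lra.
    - exists (flat_map (fun g => map (mul g) S) l). intros y Hy.
      rewrite S_INR in Hy.
      destruct (Hg x0 y) as [c Hc].
      pose proof (metric_nonneg d Hm x0 y) as Hp.
      (* The minimum covers the case where [y] already lies in the smaller ball. *)
      pose (t := Rmin (d x0 y) (INR n * (eps / 2))).
      assert (Hn0 : 0 <= INR n * (eps / 2)) by (pose proof (pos_INR n); nra).
      assert (Ht : 0 <= t <= d x0 y)
        by (unfold t; split; [apply Rmin_glb; auto|apply Rmin_l]).
      assert (Htn : t <= INR n * (eps / 2)) by apply Rmin_r.
      assert (Hty : d x0 y - t <= eps / 2).
      { unfold t, Rmin. destruct (Rle_dec (d x0 y) (INR n * (eps / 2))); lra. }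
      destruct (IH (c t)) as (g & k & Hgl & Hk & E).
      { rewrite (proj1 (geod_initial d _ _ _ _ Hc Ht)). auto. }
      destruct (Hcov y) as (h & k' & Hk' & E').
      exists h, k'. split; [|auto].
      apply in_flat_map. exists g. split; auto.
      replace h with (mul g (mul (inv g) h)).
      2:{ destruct HG as (Ha & Hee & Hi). rewrite Ha, (proj2 (Hi g)). apply Hee. }
      apply in_map. apply HS. exists k', k. split; auto. split; auto.
      rewrite <- (A3 g), <- A2.
      replace (mul g (mul (inv g) h)) with h.
      2:{ destruct HG as (Ha & Hee & Hi). rewrite Ha, (proj2 (Hi g)). symmetry. apply Hee. }
      rewrite E, E'. rewrite <- (proj1 (proj2 Hc)) at 1.
      rewrite (proj2 (proj2 Hc)) by lra. rewrite Rabs_minus_sym, Rabs_pos_eq by lra. lra. }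
  intros r. destruct (nfloor_ex (Rmax 0 (r / (eps / 2))) (Rmax_l _ _)) as (n & Hn1 & Hn2).
  destruct (Hn (n + 1)%nat) as [l Hl]. exists l. intros y Hy. apply Hl.
  rewrite plus_INR. simpl.
  pose proof (Rmax_r 0 (r / (eps / 2))).
  assert (r = r / (eps / 2) * (eps / 2)) by (field; lra). nra.
Qed.

Lemma compact_translates {G X : Type} (mul : G -> G -> G) (e : G)
  (d : X -> X -> R) (act : G -> X -> X) (K : X -> Prop) (l : list G) :
  isometric_action mul e d act -> m_compact d K ->
  m_compact d (fun y => exists g k, In g l /\ K k /\ act g k = y).
Proof.
  intros (A1 & A2 & A3) HK. induction l as [|g l IH]; intros I U HU Hcov.
  - exists nil. intros x (g & k & [] & _).
  - destruct (HK I (fun i x => U i (act g x))) as [l1 H1].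
    { intros i x Hx. destruct (HU i _ Hx) as (r & Hr & H). exists r. split; auto.
      intros y Hy. apply H. now rewrite A3. }
    { intros x Hx. apply Hcov. exists g, x. split; auto. now left. }
    destruct (IH I U HU) as [l2 H2].
    { intros x (h & k & Hh & Hk). apply Hcov. exists h, k. split; auto. now right. }
    exists (l1 ++ l2). intros x (h & k & [<-|Hh] & Hk & <-).
    + destruct (H1 k Hk) as (i & Hi & Hu). exists i. split; auto. apply in_or_app; auto.
    + destruct (H2 (act h k)) as (i & Hi & Hu); [eauto|].
      exists i. split; auto. apply in_or_app; auto.
Qed.

(** A form of properness of [X]: balls only have to lie in compact sets, which is what finitely many
    translates of a compact set provide directly. *)
Definition bounded_in_compact {X : Type} (d : X -> X -> R) (x0 : X) : Prop :=
  forall r, exists C, m_compact d C /\ forall y, d x0 y <= r -> C y.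

Lemma geometric_bounded_in_compact {G X : Type} (mul : G -> G -> G) (inv : G -> G) (e : G)
  (d : X -> X -> R) (act : G -> X -> X) (x0 : X) :
  is_group mul inv e -> is_metric d -> geodesic_space d -> geometric_action mul e d act ->
  bounded_in_compact d x0.
Proof.
  intros HG Hm Hg HA r.
  destruct (bounded_finite_translates mul inv e d act x0 HG Hm Hg HA) as (K & HK & H).
  destruct (H r) as [l Hl].
  exists (fun y => exists g k, In g l /\ K k /\ act g k = y). split; auto.
  apply (compact_translates mul e); auto. apply HA.
Qed.

(** * Limits of geodesics and asymptotic rays *)

Lemma cauchy_converges {X : Type} (d : X -> X -> R) (x0 : X) (u : nat -> X) :
  is_metric d -> bounded_in_compact d x0 ->
  (forall eps, 0 < eps -> exists N, forall n m, (N <= n)%nat -> (N <= m)%nat ->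
     d (u n) (u m) <= eps) ->
  exists x, forall eps, 0 < eps -> exists N, forall n, (N <= n)%nat -> d x (u n) <= eps.
Proof.
  intros Hm HB Hu. apply NNPP. intros Hno.
  destruct (Hu 1 ltac:(lra)) as [N1 HN1].
  destruct (HB (d x0 (u N1) + 1)) as (C & HC & HCb).
  (* Without a limit, each point has a ball that all terms avoid from some rank on. A finite
     subcover of [C] gives a common rank, but a later term lies in [C]. An index is a center, a
     radius and a rank. *)
  destruct (HC (X * (R * nat))%type (fun p y =>
    (forall n, (snd (snd p) <= n)%nat -> fst (snd p) <= d (fst p) (u n)) /\
    d (fst p) y < fst (snd p))) as [l Hl].
  { intros p. apply m_open_ball; auto. }
  { intros x _.
    destruct (not_all_ex_not _ _ (fun H => Hno (ex_intro _ x H))) as [eps Heps].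
    apply imply_to_and in Heps. destruct Heps as [He Hn].
    destruct (Hu (eps / 2) ltac:(lra)) as [N HN].
    exists (x, (eps / 2, N)). simpl. split.
    - intros n Hle. apply Rnot_lt_le. intros Hlt. apply Hn. exists N. intros m Hmm.
      pose proof (HN n m Hle Hmm). pose proof (metric_tri d Hm x (u n) (u m)). lra.
    - rewrite (metric_refl d Hm). lra. }
  assert (HM : exists M, forall p, In p l -> (snd (snd p) <= M)%nat).
  { clear. induction l as [|p l [M HM]]; [exists 0%nat; intros p []|].
    exists (Nat.max M (snd (snd p))). intros q [<-|Hq]; [lia|].
    specialize (HM q Hq). lia. }
  destruct HM as [M HM].
  destruct (Hl (u (Nat.max M N1))) as (p & Hp & Hp1 & Hp2).
  { apply HCb. pose proof (HN1 N1 (Nat.max M N1) ltac:(lia) ltac:(lia)).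
    pose proof (metric_tri d Hm x0 (u N1) (u (Nat.max M N1))). lra. }
  specialize (HM p Hp). specialize (Hp1 (Nat.max M N1) ltac:(lia)). lra.
Qed.

(** Subsequences are represented by infinite sets of indices, so that extracting one means passing
    to a subset. *)
Definition frequently (I : nat -> Prop) : Prop := forall N, exists n, (N <= n)%nat /\ I n.

Lemma frequently_pigeonhole {A : Type} (l : list A) (P : A -> nat -> Prop) (I : nat -> Prop) :
  frequently I ->
  (exists N, forall n, (N <= n)%nat -> I n -> exists a, In a l /\ P a n) ->
  exists a, frequently (fun n => I n /\ P a n).
Proof.
  intros HI. induction l as [|a l IH]; intros [N HN].
  - destruct (HI N) as (n & Hn & Hi). destruct (HN n Hn Hi) as (a & [] & _).
  - destruct (classic (frequently (fun n => I n /\ P a n))) as [H|H]; [eauto|].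
    apply not_all_ex_not in H. destruct H as [N' HN'].
    apply IH. exists (Nat.max N N'). intros n Hn Hi.
    destruct (HN n ltac:(lia) Hi) as (b & [<-|Hb] & Hp); [|eauto].
    exfalso. apply HN'. exists n. split; [lia|auto].
Qed.

(* Diagonal extraction. It suffices to make the selected geodesics 1-close at each
   integer time [m]: by convexity they are then [s / m]-close at time [s]. *)
Lemma limit_ray {X : Type} (d : X -> X -> R) (x0 : X) (p : nat -> X) (c : nat -> R -> X) :
  is_metric d -> CAT0 d -> bounded_in_compact d x0 ->
  (forall n, INR n <= d x0 (p n)) -> (forall n, geod d x0 (p n) (c n)) ->
  exists r, ray_from d x0 r /\
    forall S, 0 <= S -> forall N, exists n, (N <= n)%nat /\ d (r S) (c n S) <= 1.
Proof.
  intros Hm HC HB Hp Hc.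
  assert (Hrad : forall n s, 0 <= s <= INR n -> d x0 (c n s) = s /\ geod d x0 (c n s) (c n)).
  { intros n s Hs. apply (geod_initial d x0 (p n)); auto. pose proof (Hp n). lra. }
  pose (close := fun m n n' => d (c n (INR m)) (c n' (INR m)) <= 1).
  assert (Hstep : forall m (I : {I | frequently I}), exists J : {J | frequently J},
    (forall n, proj1_sig J n -> proj1_sig I n) /\
    forall n n', proj1_sig J n -> proj1_sig J n' -> close m n n').
  { intros m [I HI]. destruct (HB (INR m)) as (C & HCc & HCb).
    (* Finitely many balls of radius [1 / 2] cover the points at time [m]; infinitely many indices
       share one ball and are therefore 1-close. *)
    destruct (HCc X (fun a y => True /\ d a y < 1 / 2)) as [l Hl].
    { intros a. apply m_open_ball; auto. }
    { intros x _. exists x. rewrite (metric_refl d Hm). lra. }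
    destruct (frequently_pigeonhole l (fun a n => d a (c n (INR m)) < 1 / 2) I HI) as [a Ha].
    { exists m. intros n Hn _. destruct (Hl (c n (INR m))) as (a & Hal & _ & Ha); [|eauto].
      apply HCb. right. apply Hrad. split; [apply pos_INR|now apply le_INR]. }
    exists (exist _ _ Ha). simpl. split; [tauto|].
    intros n n' [_ H1] [_ H2]. unfold close.
    pose proof (metric_tri d Hm (c n (INR m)) a (c n' (INR m))).
    rewrite (metric_sym d Hm _ a) in H. lra. }
  assert (H0 : frequently (fun _ => True)) by (intros N; exists N; auto).
  pose (J := fix J m := match m with
    | O => exist frequently _ H0
    | S m => proj1_sig (constructive_indefinite_description _ (Hstep m (J m))) end).
  assert (HJ : forall m, (forall n, proj1_sig (J (S m)) n -> proj1_sig (J m) n) /\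
    forall n n', proj1_sig (J (S m)) n -> proj1_sig (J (S m)) n' -> close m n n').
  { intros m. simpl. apply (proj2_sig (constructive_indefinite_description _ (Hstep m (J m)))). }
  assert (HJle : forall m m', (m <= m')%nat ->
    forall n, proj1_sig (J m') n -> proj1_sig (J m) n).
  { intros m m' Hle. induction Hle; auto. intros n Hn. apply IHHle. now apply HJ. }
  assert (Hex : forall m, exists n, (m <= n)%nat /\ proj1_sig (J (S m)) n)
    by (intros m; apply (proj2_sig (J (S m)))).
  (* Diagonal choice: as the sets [J] decrease, [k m] and every [k m'] with [m <= m'] lie in
     [J (S m)], and [m <= k m] makes the geodesic long enough to be evaluated at time [m]. *)
  pose (k := fun m => proj1_sig (constructive_indefinite_description _ (Hex m))).
  assert (Hk : forall m, (m <= k m)%nat /\ proj1_sig (J (S m)) (k m))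
    by (intros m; apply (proj2_sig (constructive_indefinite_description _ (Hex m)))).
  assert (Hclose : forall m m' s, (m <= m')%nat -> 0 < INR m -> 0 <= s <= INR m ->
    d (c (k m) s) (c (k m') s) <= s / INR m).
  { intros m m' s Hle Hm0 Hs.
    destruct (Hk m) as [Hk1 Hk2]. destruct (Hk m') as [Hk1' Hk2'].
    apply le_INR in Hk1. pose proof (le_INR _ _ Hle). apply le_INR in Hk1'.
    pose proof (proj2 (HJ m) (k m) (k m') Hk2
      (HJle (S m) (S m') ltac:(lia) _ Hk2')) as Hcl. unfold close in Hcl.
    destruct (Hrad (k m) (INR m) ltac:(lra)) as [E1 G1].
    destruct (Hrad (k m') (INR m) ltac:(lra)) as [E2 G2].
    pose proof (convex_initial d Hm HC _ _ _ _ _ s G1 G2 E1 E2 Hm0 Hs) as Hcv.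
    rewrite (metric_refl d Hm) in Hcv.
    assert (0 <= s / INR m) by (apply Rdiv_le_0_compat; lra). nra. }
  (* The condition [0 <= s] sits under the existential so that a value can be chosen for every real
     [s]; at negative times it is [x0]. *)
  assert (Hlim : forall s, exists x, 0 <= s -> forall eps, 0 < eps ->
    exists N, forall m, (N <= m)%nat -> d x (c (k m) s) <= eps).
  { intros s. destruct (Rle_dec 0 s) as [Hs|Hs]; [|exists x0; lra].
    destruct (cauchy_converges d x0 (fun m => c (k m) s) Hm HB) as [x Hx]; [|eauto].
    intros eps He.
    assert (Hq : 0 <= 2 * s / eps) by (apply Rdiv_le_0_compat; lra).
    (* This rank exceeds both [s], as [Hclose] requires, and [2 * s / eps], so each of the two gaps
       is at most [eps / 2]. *)
    destruct (nfloor_ex (s + 1 + 2 * s / eps)) as (N & _ & HN); [lra|].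
    exists (S N). rewrite <- S_INR in HN.
    assert (HsN : s / INR (S N) <= eps / 2).
    { apply Rle_div_l; [lra|].
      replace s with (2 * s / eps * (eps / 2)) at 1 by (field; lra). nra. }
    intros n m Hn Hmm.
    pose proof (Hclose (S N) n s Hn ltac:(lra) ltac:(lra)).
    pose proof (Hclose (S N) m s Hmm ltac:(lra) ltac:(lra)).
    pose proof (metric_tri d Hm (c (k n) s) (c (k (S N)) s) (c (k m) s)) as Htri.
    rewrite (metric_sym d Hm (c (k n) s) (c (k (S N)) s)) in Htri. lra. }
  pose (r := fun s => proj1_sig (constructive_indefinite_description _ (Hlim s))).
  assert (Hr : forall s, 0 <= s -> forall eps, 0 < eps ->
    exists N, forall m, (N <= m)%nat -> d (r s) (c (k m) s) <= eps)
    by (intros s; apply (proj2_sig (constructive_indefinite_description _ (Hlim s)))).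
  exists r. split; [split|].
  - apply (proj1 Hm). pose proof (metric_nonneg d Hm (r 0) x0).
    apply Rle_antisym; auto. apply le_epsilon. intros eps He.
    destruct (Hr 0 ltac:(lra) eps He) as [N HN]. specialize (HN N ltac:(lia)).
    rewrite (proj1 (Hc _)) in HN. lra.
  - intros s t Hs Ht. apply cond_eq. intros eps He.
    destruct (Hr s Hs (eps / 3) ltac:(lra)) as [N1 HN1].
    destruct (Hr t Ht (eps / 3) ltac:(lra)) as [N2 HN2].
    (* Beyond [s + t] both times fall within the length of [c (k m)], where it is isometric. *)
    destruct (nfloor_ex (s + t) ltac:(lra)) as (N & _ & HN). rewrite <- S_INR in HN.
    pose (m := Nat.max (S N) (Nat.max N1 N2)).
    specialize (HN1 m ltac:(lia)). specialize (HN2 m ltac:(lia)).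
    assert (HkN : INR (S N) <= INR (k m))
      by (apply le_INR; pose proof (proj1 (Hk m)); lia).
    pose proof (Hp (k m)).
    pose proof (proj2 (proj2 (Hc (k m))) s t ltac:(lra) ltac:(lra)) as Hst.
    rewrite <- Hst.
    pose proof (metric_tri d Hm (r s) (c (k m) s) (r t)).
    pose proof (metric_tri d Hm (c (k m) s) (c (k m) t) (r t)).
    pose proof (metric_tri d Hm (c (k m) s) (r s) (c (k m) t)).
    pose proof (metric_tri d Hm (r s) (r t) (c (k m) t)).
    rewrite (metric_sym d Hm (c (k m) s) (r s)) in *.
    rewrite (metric_sym d Hm (c (k m) t) (r t)) in *.
    apply Rabs_def1; lra.
  - intros s Hs N. destruct (Hr s Hs 1 ltac:(lra)) as [M HM].
    exists (k (Nat.max M N)). split; [|apply HM; lia].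
    pose proof (proj1 (Hk (Nat.max M N))). lia.
Qed.

(** Geodesics from [x0] to far points of [b] stay within [3 * d x0 z] of [b], and a limit ray is at
    each time within 1 of some of them. This shows that the choice made in [bd_act] has a
    witness. *)
Lemma asymptotic_ray_exists {X : Type} (d : X -> X -> R) (x0 z : X) (b : R -> X) :
  is_metric d -> CAT0 d -> bounded_in_compact d x0 -> ray_from d z b ->
  exists c, ray_from d x0 c /\ asymptotic d c b.
Proof.
  intros Hm HC HB Hb.
  pose proof (metric_nonneg d Hm x0 z) as Hz.
  destruct (nfloor_ex (d x0 z) Hz) as (N0 & _ & HN0). rewrite <- S_INR in HN0.
  (* The shift by [S N0], which exceeds [d x0 z], ensures that the [n]-th point is at distance at
     least [n] from [x0]. *)
  pose (p := fun n => b (INR (n + S N0))).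
  assert (Hb' : forall n, d z (p n) = INR (n + S N0) /\ geod d z (p n) b)
    by (intros n; exact (ray_initial d z b _ Hb (pos_INR _))).
  destruct (choice (fun n c => geod d x0 (p n) c) (fun n => proj1 HC x0 (p n))) as [c Hc].
  assert (Hp : forall n, INR n <= d x0 (p n)).
  { intros n. pose proof (metric_tri d Hm z x0 (p n)). rewrite (proj1 (Hb' n)), plus_INR in H.
    rewrite (metric_sym d Hm z x0) in H. lra. }
  destruct (limit_ray d x0 p c Hm HC HB Hp Hc) as (r & Hr & Hrc).
  exists r. split; auto. exists (1 + 3 * d x0 z). intros t Ht.
  destruct (nfloor_ex t Ht) as (N & _ & HN). rewrite <- S_INR in HN.
  destruct (Hrc t Ht (S N)) as (n & Hn & Hd). apply le_INR in Hn.
  pose proof (Hp n). pose proof (proj1 (Hb' n)). pose proof (pos_INR (S N0)).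
  rewrite plus_INR in H0.
  pose proof (geod_fellow_travel d Hm HC _ _ _ _ _ _ (d x0 z) t (Hc n) (proj2 (Hb' n))
    (Rle_refl _) ltac:(rewrite (metric_refl d Hm); auto) ltac:(lra) ltac:(lra)).
  pose proof (metric_tri d Hm (r t) (c n t) (b t)). lra.
Qed.

(** * Directions of the two factors *)

Lemma unbounded_far {X : Type} (d : X -> X -> R) (a : X) (M : R) :
  is_metric d -> unbounded d -> exists x, M <= d a x.
Proof.
  intros Hm Hu. destruct (Hu (2 * M)) as (x & y & H).
  pose proof (metric_tri d Hm x a y). rewrite (metric_sym d Hm x a) in H0.
  destruct (Rle_dec M (d a x)); [eauto|]. exists y. lra.
Qed.

(* A limit of geodesics towards [f (a_n, b0)] moves in the first factor only, up to
   an error of order [sqrt T], uniformly in the starting point of the asymptotic ray. *)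
Lemma factor_direction {X X1 X2 : Type} (d : X -> X -> R) (d1 : X1 -> X1 -> R)
  (d2 : X2 -> X2 -> R) (f : X1 -> X2 -> X) (x0 : X) (K : R) (b0 : X2) :
  is_metric d -> CAT0 d -> bounded_in_compact d x0 ->
  is_metric d1 -> is_metric d2 -> unbounded d1 -> 0 < K ->
  (forall z, exists x y, d z (f x y) <= K) ->
  (forall x y x' y', d (f x y) (f x' y') = sqrt (d1 x x' ^ 2 + d2 y y' ^ 2)) ->
  exists alpha, ray_from d x0 alpha /\
    forall q0 r y1 y2, ray_from d q0 r -> asymptotic d r alpha -> d q0 (f y1 y2) <= K ->
    forall T, K <= T -> exists u v,
      d (r T) (f u v) <= 2 * K + 1 /\ T - K <= d1 y1 u /\ d2 y2 v ^ 2 <= 4 * T * K.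
Proof.
  intros Hm HC HB Hm1 Hm2 Hu1 HK Hqd Hf.
  assert (Hf1 : forall x x' y, d (f x y) (f x' y) = d1 x x').
  { intros. rewrite Hf, (metric_refl d2 Hm2).
    replace (d1 x x' ^ 2 + 0 ^ 2) with (d1 x x' * d1 x x') by ring.
    apply sqrt_square, metric_nonneg; auto. }
  assert (Hf2 : forall x y y', d (f x y) (f x y') = d2 y y').
  { intros. rewrite Hf, (metric_refl d1 Hm1).
    replace (0 ^ 2 + d2 y y' ^ 2) with (d2 y y' * d2 y y') by ring.
    apply sqrt_square, metric_nonneg; auto. }
  assert (Hsq : forall x y x' y', d (f x y) (f x' y') ^ 2 = d1 x x' ^ 2 + d2 y y' ^ 2).
  { intros. rewrite Hf. apply pow2_sqrt.
    pose proof (pow2_ge_0 (d1 x x')). pose proof (pow2_ge_0 (d2 y y')). lra. }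
  assert (Hle1 : forall x y x' y', d1 x x' <= d (f x y) (f x' y')).
  { intros. rewrite <- (Hf1 x x' y), !Hf, (metric_refl d2 Hm2).
    apply sqrt_le_1_alt. pose proof (pow2_ge_0 (d2 y y')). lra. }
  destruct (Hu1 0) as (a0 & _ & _).
  destruct (choice (fun (n : nat) a => INR n + d x0 (f a0 b0) <= d1 a0 a)
    (fun n => unbounded_far d1 a0 _ Hm1 Hu1)) as [a Ha].
  pose (p := fun n => f (a n) b0).
  destruct (choice (fun n c => geod d x0 (p n) c) (fun n => proj1 HC x0 (p n))) as [c Hc].
  assert (Hp : forall n, INR n <= d x0 (p n)).
  { intros n. pose proof (metric_tri d Hm (f a0 b0) x0 (p n)). unfold p in *.
    rewrite Hf1, (metric_sym d Hm (f a0 b0)) in H. specialize (Ha n). lra. }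
  destruct (limit_ray d x0 p c Hm HC HB Hp Hc) as (alpha & Halpha & Hlim).
  exists alpha. split; auto.
  intros q0 r y1 y2 Hr [C HCr] Hq T HT.
  (* [E] bounds the distances between corresponding endpoints of [c n] and of the geodesic [m]
     below, from [f y1 y2] to [f (a n) y2]. *)
  pose (E := d x0 (f y1 y2) + d2 b0 y2).
  pose proof (metric_nonneg d Hm x0 (f y1 y2)) as Hx0.
  pose proof (metric_nonneg d2 Hm2 b0 y2) as Hb0.
  assert (HC0 : 0 <= C).
  { eapply Rle_trans; [|apply (HCr 0); lra]. apply metric_nonneg; auto. }
  (* At time [S] the ray [r] and [m] will be within [C + 1 + 3 * E]: [C] from [r] to [alpha], 1 from
     [alpha] to [c n], [3 * E] from [c n] to [m]. This [S] makes [T / S] times that bound at most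
     1. *)
  pose (S := T * (C + 1 + 3 * E) + T + 1).
  assert (HE : 0 <= E) by (unfold E; lra).
  assert (HST : T < S) by (unfold S; nra).
  destruct (nfloor_ex (S + E)) as (N & _ & HN); [lra|]. rewrite <- S_INR in HN.
  destruct (Hlim S ltac:(lra) (Datatypes.S N)) as (n & Hn & Hd). apply le_INR in Hn.
  pose proof (Hp n) as Hpn.
  pose (w := f (a n) y2). pose (D := d1 y1 (a n)).
  assert (HD : d (f y1 y2) w = D) by apply Hf1.
  destruct (proj1 HC (f y1 y2) w) as [m Hmg].
  assert (Hpw : d (p n) w = d2 b0 y2) by apply Hf2.
  assert (HSD : S <= D).
  { rewrite <- HD. pose proof (metric_tri d Hm x0 (f y1 y2) (p n)).
    pose proof (metric_tri d Hm (f y1 y2) w (p n)).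
    rewrite (metric_sym d Hm w (p n)) in *. unfold E in *. lra. }
  assert (HS1 : d (c n S) (m S) <= 3 * E).
  { apply (geod_fellow_travel d Hm HC _ _ _ _ _ _ E S (Hc n) Hmg);
      unfold E in *; lra. }
  assert (HrS : d (r S) (m S) <= C + 1 + 3 * E).
  { pose proof (HCr S ltac:(lra)).
    pose proof (metric_tri d Hm (r S) (alpha S) (m S)).
    pose proof (metric_tri d Hm (alpha S) (c n S) (m S)). lra. }
  assert (HrT : d (r T) (m T) <= K + 1).
  { destruct (ray_initial d _ _ S Hr ltac:(lra)) as [E1 G1].
    destruct (geod_initial d _ _ _ S Hmg ltac:(lra)) as [E2 G2].
    pose proof (convex_initial d Hm HC _ _ _ _ _ T G1 G2 E1 E2 ltac:(lra) ltac:(lra)) as Hcv.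
    assert (0 <= T / S) by (apply Rdiv_le_0_compat; lra).
    assert (T / S <= 1) by (apply Rle_div_l; lra).
    assert (T / S * (C + 1 + 3 * E) <= 1).
    { replace (T / S * (C + 1 + 3 * E)) with ((T * (C + 1 + 3 * E)) / S) by (field; lra).
      apply Rle_div_l; unfold S in *; lra. }
    nra. }
  (* The geodesic [m] may leave the product, so [m T] is replaced by a product point within [K]. It
     is nearly on the way from [f y1 y2] to [w], which differ only in the first factor, so the first
     coordinate must advance by at least [T - K]. *)
  destruct (Hqd (m T)) as (u & v & Huv). exists u, v.
  destruct (geod_initial d _ _ _ T Hmg ltac:(lra)) as [ET _].
  assert (EDT : d (m T) w = D - T).
  { rewrite <- (proj1 (proj2 Hmg)) at 1. rewrite (proj2 (proj2 Hmg)) by lra.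
    rewrite HD, Rabs_minus_sym. apply Rabs_pos_eq. lra. }
  pose proof (metric_tri d Hm (f y1 y2) (m T) (f u v)) as T1.
  pose proof (metric_tri d Hm (f u v) (m T) w) as T2.
  rewrite (metric_sym d Hm (f u v) (m T)) in T2.
  pose proof (Hle1 u v (a n) y2) as T3. fold w in T3.
  pose proof (metric_tri d1 Hm1 y1 u (a n)) as T4. fold D in T4.
  assert (Hfar : T - K <= d1 y1 u) by lra.
  split; [pose proof (metric_tri d Hm (r T) (m T) (f u v)); lra|]. split; auto.
  (* By Pythagoras the second coordinate moves by at most the square root of
     [(T + K) ^ 2 - (T - K) ^ 2 = 4 * T * K]. *)
  pose proof (Hsq y1 y2 u v) as Hs.
  pose proof (metric_nonneg d Hm (f y1 y2) (f u v)).
  assert ((T - K) ^ 2 <= d1 y1 u ^ 2) by (apply pow_incr; lra).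
  assert (d (f y1 y2) (f u v) ^ 2 <= (T + K) ^ 2) by (apply pow_incr; lra).
  nra.
Qed.

(** * Lower bounds for the boundary metric and the conclusion *)

Lemma bd_dist_lower_bound {X : Type} (d : X -> X -> R) (alpha beta : R -> X) (n : nat) :
  is_metric d -> 1 <= d (alpha (INR (S n))) (beta (INR (S n))) ->
  / 2 ^ S n <= bd_dist d alpha beta.
Proof.
  intros Hm Hn. unfold bd_dist.
  set (a := fun n : nat => Rmin (d (alpha (INR (S n))) (beta (INR (S n)))) (/ 2 ^ S n)).
  assert (Ha : forall k, 0 <= a k).
  { intros k. apply Rmin_glb; [apply metric_nonneg; auto|].
    left. apply Rinv_0_lt_compat, pow_lt. lra. }
  assert (Hex : ex_series a).
  { apply (@ex_series_le R_AbsRing R_CompleteNormedModule a (fun k => (/ 2) ^ k)).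
    - intros k. unfold norm; simpl. unfold abs; simpl. rewrite Rabs_pos_eq by auto.
      eapply Rle_trans; [apply Rmin_r|]. rewrite pow_inv. simpl.
      apply Rinv_le_contravar; [apply pow_lt; lra|].
      pose proof (pow_lt 2 k ltac:(lra)). lra.
    - apply ex_series_geom. rewrite Rabs_pos_eq; lra. }
  (* A gap of at least 1 makes the cap the smaller entry of this term. All terms being nonnegative,
     this one alone bounds the sum from below. *)
  assert (Han : a n = / 2 ^ S n).
  { apply Rmin_right. eapply Rle_trans; [|exact Hn].
    rewrite <- Rinv_1. apply Rinv_le_contravar; [lra|]. apply pow_R1_Rle. lra. }
  rewrite <- Han, (Series_incr_n a (S n)) by (auto; lia).
  simpl pred.
  assert (Ht : 0 <= Series (fun k => a (S n + k)%nat)).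
  { rewrite <- (Rmult_0_l (Series (fun k => a (S n + k)%nat))), <- Series_scal_l.
    apply Series_le; [|now apply ex_series_incr_n].
    intros k. specialize (Ha (S n + k)%nat). lra. }
  assert (Hs : a n <= sum_f_R0 a n).
  { destruct n; simpl; [lra|]. pose proof (cond_pos_sum a n Ha). lra. }
  lra.
Qed.

Theorem theorem5p5 (G : Type) (mul : G -> G -> G) (inv : G -> G) (e : G)
  (X : Type) (d : X -> X -> R) (act : G -> X -> X) (x0 : X) :
  is_group mul inv e ->
  is_metric d ->
  CAT0 d ->
  geometric_action mul e d act ->
  (exists a b c : R -> X,
      ray_from d x0 a /\ ray_from d x0 b /\ ray_from d x0 c /\
      ~ same_ray a b /\ ~ same_ray b c /\ ~ same_ray a c) ->
  has_quasi_dense_unbounded_product d ->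
  ~ scrambled d act x0.
Proof.
  intros HG Hm HC HA _ (A & X1 & X2 & d1 & d2 & (K & HK & Hqd) & Hm1 & Hm2 & Hu1 & Hu2 &
    phi & HAphi & Hphi) Hscr.
  pose proof (geometric_bounded_in_compact mul inv e d act x0 HG Hm (proj1 HC) HA) as HB.
  pose (f := fun x y => phi (x, y)).
  assert (Hf : forall x y x' y', d (f x y) (f x' y') = sqrt (d1 x x' ^ 2 + d2 y y' ^ 2))
    by (intros; apply Hphi).
  assert (Hq : forall z, exists x y, d z (f x y) <= K).
  { intros z. destruct (Hqd z) as (b & Hb & Hd). apply HAphi in Hb.
    destruct Hb as [[x y] <-]. exists x, y. exact Hd. }
  destruct (Hu1 0) as (a0 & _ & _). destruct (Hu2 0) as (b0 & _ & _).
  destruct (factor_direction d d1 d2 f x0 K b0) as (alpha & Ha & Hadir); auto.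
  destruct (factor_direction d d2 d1 (fun y x => f x y) x0 K a0) as (beta & Hb & Hbdir); auto.
  { intros z. destruct (Hq z) as (x & y & H). eauto. }
  { intros. rewrite Hf. f_equal. ring. }
  (* [T >= 16 * K] turns [4 * T * K] into at most [(T / 2) ^ 2], and [T >= 10 * K + 6] gives
     [(T - K) - T / 2 - 2 * (2 * K + 1) >= 1]. [T] is an integer because [bd_dist] samples rays at
     integer times. *)
  destruct (nfloor_ex (26 * K + 6)) as (n & _ & Hn); [lra|]. rewrite <- S_INR in Hn.
  set (T := INR (S n)) in *.
  assert (Hsep : forall q0 r r', ray_from d q0 r -> ray_from d q0 r' ->
    asymptotic d r alpha -> asymptotic d r' beta -> 1 <= d (r T) (r' T)).
  { intros q0 r r' Hr Hr' Hra Hrb. destruct (Hq q0) as (y1 & y2 & Hy).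
    destruct (Hadir q0 r y1 y2 Hr Hra Hy T ltac:(lra)) as (u & v & H1 & H2 & _).
    destruct (Hbdir q0 r' y2 y1 Hr' Hrb Hy T ltac:(lra)) as (v' & u' & H1' & _ & H3').
    cbv beta in H1'.
    assert (Hu' : d1 y1 u' <= T / 2).
    { apply Rsqr_incr_0_var; [|lra]. unfold Rsqr. nra. }
    assert (Huu : d1 u u' <= d (f u v) (f u' v')).
    { rewrite Hf. rewrite <- (sqrt_pow2 (d1 u u')) at 1 by (apply metric_nonneg; auto).
      apply sqrt_le_1_alt. pose proof (pow2_ge_0 (d2 v v')). lra. }
    pose proof (metric_tri d1 Hm1 y1 u' u). rewrite (metric_sym d1 Hm1 u' u) in H.
    pose proof (metric_tri d Hm (f u v) (r T) (f u' v')).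
    pose proof (metric_tri d Hm (r T) (r' T) (f u' v')).
    rewrite (metric_sym d Hm (f u v) (r T)) in H0. lra. }
  assert (Hrefl : forall c, asymptotic d c c).
  { intros c. exists 0. intros t _. rewrite (metric_refl d Hm). lra. }
  destruct (Hscr alpha beta Ha Hb) as [_ Hinf].
  { intros Hs. pose proof (Hsep x0 alpha beta Ha Hb (Hrefl _) (Hrefl _)).
    rewrite (Hs T), (metric_refl d Hm) in H by apply pos_INR. lra. }
  (* The liminf condition is contradicted: the lower bound [/ 2 ^ S n] holds for every [g], so the
     empty list can be taken for [F]. *)
  destruct (Hinf (/ 2 ^ S n)) with (F := @nil G) as (g & _ & Hg).
  { apply Rinv_0_lt_compat, pow_lt. lra. }
  apply (Rlt_not_le _ _ Hg), bd_dist_lower_bound; auto. fold T.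
  destruct HA as (HI & _). assert (HI' := HI). destruct HI' as (A1 & A2 & A3).
  assert (Hact : forall h x c, ray_from d x c -> ray_from d (act h x) (fun t => act h (c t))).
  { intros h x c [H0 H1]. split; [now rewrite H0|]. intros. rewrite A3. auto. }
  (* Pulling back by [inv g] turns the image rays into rays from [act (inv g) x0] asymptotic to the
     original ones, so [Hsep] applies with this common origin. *)
  assert (Hbd : forall c, ray_from d x0 c ->
    ray_from d x0 (bd_act d act x0 g c) /\
    asymptotic d (fun t => act (inv g) (bd_act d act x0 g c t)) c).
  { intros c Hc.
    destruct (epsilon_spec (inhabits (fun _ : R => x0))
      (fun c' => ray_from d x0 c' /\ asymptotic d c' (fun t => act g (c t)))) as [R1 [C R2]].
    { apply (asymptotic_ray_exists d x0 (act g x0)); auto. }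
    split; [exact R1|]. exists C. intros t Ht.
    rewrite <- (A3 g), (act_inv_r mul inv e d act HG HI). apply R2, Ht. }
  destruct (Hbd alpha Ha) as [Ra Aa]. destruct (Hbd beta Hb) as [Rb Ab].
  rewrite <- (A3 (inv g)).
  apply (Hsep (act (inv g) x0) _ _ (Hact (inv g) _ _ Ra) (Hact (inv g) _ _ Rb) Aa Ab).
Qed.
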